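(* Let $\mathbb K$ be an algebraically closed field of characteristic $p>0$. (a1) Let $p=2$, $\mathfrak g=\mathfrak{gl}(4)$. For a basis of $H^1(\mathfrak g;\mathfrak g)$ one can take the class of the derivation $c_0=h_1\otimes\widehat D_4+h_3\otimes\widehat D_4$. (a2) $H^2(\mathfrak{gl}(4))=0$ for $p=2$. (b1) Let $p>2$, $\mathfrak g=\mathfrak{gl}(2|2)$. For a basis of $H^1(\mathfrak g;\mathfrak g)$ one can take the class of the derivation $c_0=-h_1\otimes\widehat D_4+(p-2)h_2\otimes\widehat D_4+h_3\otimes\widehat D_4$. (b2) $H^2(\mathfrak{gl}(2|2))=0$ for $p>2$. (c1) Let $p>2$, $\mathfrak g=\mathfrak{gl}(1|3)$. For a basis of $H^1(\mathfrak g;\mathfrak g)$ one can take the class of the derivation $c_0=(p-3)h_1\otimes\widehat D_4+2h_2\otimes\widehat D_4+h_3\otimes\widehat D_4+2D_4\otimes\widehat D_4$. (c2) $H^2(\mathfrak{gl}(1|3))=0$ for $p>2$.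
   Context: Matrices are written in the standard format (even indices first). $x_i=E_{i,i+1}$, $y_i=E_{i+1,i}$, $h_i=[x_i,y_i]$ for $i=1,2,3$; thus for $\mathfrak{gl}(4)$: $h_i=E_{i,i}-E_{i+1,i+1}$; for $\mathfrak{gl}(2|2)$: $h_1=E_{1,1}-E_{2,2}$, $h_2=E_{2,2}+E_{3,3}$, $h_3=E_{3,3}-E_{4,4}$; for $\mathfrak{gl}(1|3)$: $h_1=E_{1,1}+E_{2,2}$, $h_2=E_{2,2}-E_{3,3}$, $h_3=E_{3,3}-E_{4,4}$. $D_4=E_{1,1}$ is the element complementing the (super)traceless subalgebra; $\widehat D_4$ is the linear functional vanishing on the subalgebra of (super)traceless matrices and equal to $1$ on $D_4$; $u\otimes\widehat D_4$ is the linear map $X\mapsto\widehat D_4(X)u$. $H^1(\mathfrak g;\mathfrak g)$ is the superspace of all (even and odd) derivations modulo inner ones. $H^2(\mathfrak g)$ (trivial coefficients, both parities): super-antisymmetric bilinear forms $\omega$ (alternating for Lie algebras) with $\omega([x,y],z)=\omega(x,[y,z])-(-1)^{p(x)p(y)}\omega(y,[x,z])$ and, in the super case with $p=3$, $\omega(x,[x,x])=0$ for odd $x$, modulo the forms $f([x,y])$ with $f$ linear. *)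

(* Defs.v *)
From mathcomp Require Import all_boot all_order all_algebra.

Set Implicit Arguments.
Unset Strict Implicit.
Unset Printing Implicit Defensive.

Import GRing.Theory.
Local Open Scope ring_scope.

(** * First and second cohomology of a Lie superalgebra

    The superalgebra is given by its underlying space [V], the predicates
    [hom d] "homogeneous of parity [d]" ([false] = even, [true] = odd), and the
    bracket [br].  A Lie algebra is the case where every vector is even. *)

Definition derivation (K : fieldType) (V : lmodType K) (hom : bool -> V -> Prop)
    (br : V -> V -> V) (d : bool) (D : V -> V) : Prop :=
  [/\ linear D,
      forall (i : bool) (x : V), hom i x -> hom (i (+) d) (D x)
    & forall (i : bool) (x y : V), hom i x ->
        D (br x y) = br (D x) y + (-1) ^+ (d && i) *: br x (D y)].

Definition in_Der (K : fieldType) (V : lmodType K) (hom : bool -> V -> Prop)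
    (br : V -> V -> V) (D : V -> V) : Prop :=
  exists D0 D1 : V -> V,
    [/\ derivation hom br false D0, derivation hom br true D1
      & forall x, D x = D0 x + D1 x].

Definition inner (K : fieldType) (V : lmodType K) (br : V -> V -> V)
    (D : V -> V) : Prop :=
  exists u : V, forall x, D x = br u x.

(** The maps [s k] are homogeneous derivations whose classes form a basis of
    H^1(V; V), the quotient of [in_Der] by [inner]: they span modulo inner
    derivations, and they are linearly independent modulo inner derivations. *)
Definition H1_basis (K : fieldType) (V : lmodType K) (hom : bool -> V -> Prop)
    (br : V -> V -> V) (n : nat) (s : 'I_n -> V -> V) : Prop :=
  [/\ forall k, exists d, derivation hom br d (s k),
      forall D, in_Der hom br D ->
        exists a : 'I_n -> K, inner br (fun x => D x - \sum_k a k *: s k x)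
    & forall a : 'I_n -> K,
        inner br (fun x => \sum_k a k *: s k x) -> forall k, a k = 0].

(** The third clause is implied by the second one unless the characteristic
    is 2, where it is the alternating condition. *)
Definition superform (K : fieldType) (V : lmodType K) (hom : bool -> V -> Prop)
    (w : V -> V -> K) : Prop :=
  [/\ (forall x, scalar (w x)) /\ (forall y, scalar (w^~ y)),
      forall (i j : bool) (x y : V), hom i x -> hom j y ->
        w x y = - ((-1) ^+ (i && j) * w y x)
    & forall x : V, hom false x -> w x x = 0].

(** The cocycle identity does not involve the parity of [w], so it is satisfied
    by [w] if and only if it is satisfied by its even and odd components. *)
Definition cocycle2 (K : fieldType) (V : lmodType K) (hom : bool -> V -> Prop)
    (br : V -> V -> V) (w : V -> V -> K) : Prop :=
  [/\ superform hom w,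
      forall (i j l : bool) (x y z : V), hom i x -> hom j y -> hom l z ->
        w (br x y) z = w x (br y z) - (-1) ^+ (i && j) * w y (br x z)
    & 3 \in [pchar K] -> forall x : V, hom true x -> w x (br x x) = 0].

Definition coboundary2 (K : fieldType) (V : lmodType K) (br : V -> V -> V)
    (w : V -> V -> K) : Prop :=
  exists2 f : V -> K, scalar f & forall x y, w x y = f (br x y).

Definition H2_eq0 (K : fieldType) (V : lmodType K) (hom : bool -> V -> Prop)
    (br : V -> V -> V) : Prop :=
  forall w : V -> V -> K, cocycle2 hom br w -> coboundary2 br w.

(** * The general linear Lie superalgebra gl(m|n-m)

    It is carried by the [n x n] matrices, the first [m] indices being even;
    [m = n] gives the Lie algebra gl(n). *)

Definition ipar (n m : nat) (i : 'I_n) : bool := (m <= i)%N.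

Definition homog (K : fieldType) (n m : nat) (d : bool) (A : 'M[K]_n) : Prop :=
  forall i j, ipar m i (+) ipar m j != d -> A i j = 0.

Definition hpart (K : fieldType) (n m : nat) (d : bool) (A : 'M[K]_n) :
    'M[K]_n :=
  \matrix_(i, j) (if ipar m i (+) ipar m j == d then A i j else 0).

Definition sbr (K : fieldType) (n m : nat) (A B : 'M[K]_n) : 'M[K]_n :=
  \sum_(a : bool) \sum_(b : bool)
    (hpart m a A *m hpart m b B
       - (-1) ^+ (a && b) *: (hpart m b B *m hpart m a A)).

Definition str (K : fieldType) (n m : nat) (A : 'M[K]_n) : K :=
  \sum_i (-1) ^+ ipar m i * A i i.

(** * Elements of gl(4), gl(2|2), gl(1|3), with indices running from 1 to 4 *)

Definition Eij (K : fieldType) (i j : nat) : 'M[K]_4 :=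
  delta_mx (inord i.-1) (inord j.-1).

Definition xg (K : fieldType) (i : nat) : 'M[K]_4 := Eij K i i.+1.
Definition yg (K : fieldType) (i : nat) : 'M[K]_4 := Eij K i.+1 i.
Definition hg (K : fieldType) (m i : nat) : 'M[K]_4 := sbr m (xg K i) (yg K i).
Definition D4 (K : fieldType) : 'M[K]_4 := Eij K 1 1.

Definition is_D4hat (K : fieldType) (m : nat) (f : 'M[K]_4 -> K) : Prop :=
  [/\ scalar f, forall A, str m A = 0 -> f A = 0 & f (D4 K) = 1].

Definition tensor (K : fieldType) (V : lmodType K) (u : V) (f : V -> K) :
    V -> V :=
  fun X => f X *: u.

Notation "u \ox f" := (tensor u f) (at level 40, left associativity).

Lemma homogP (K : fieldType) (n m : nat) (d : bool) (A : 'M[K]_n) :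
  homog m d A <-> hpart m d A = A.
Proof.
split=> [hA | <- i j ij]; last by rewrite mxE (negbTE ij).
by apply/matrixP=> i j; rewrite mxE; case: eqP => // /eqP /hA ->.
Qed.

Lemma sbr_homog (K : fieldType) (n m : nat) (a b : bool) (A B : 'M[K]_n) :
  homog m a A -> homog m b B ->
  sbr m A B = A *m B - (-1) ^+ (a && b) *: (B *m A).
Proof.
have other d d' (C : 'M[K]_n) : homog m d C -> d' != d -> hpart m d' C = 0.
  move=> hC d'd; apply/matrixP=> i j; rewrite !mxE; case: eqP => // ij.
  by apply: hC; rewrite ij.
move=> hA hB; rewrite /sbr (bigD1 a) //= (bigD1 b) //= [X in _ + X + _]big1.
  rewrite big1 ?addr0 ?(homogP m a A).1 ?(homogP m b B).1 // => a' a'a.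
  rewrite big1 // => b' _.
  by rewrite (other a a' A) // mul0mx mulmx0 scaler0 subr0.
by move=> b' b'b; rewrite (other b b' B) // mul0mx mulmx0 scaler0 subr0.
Qed.

Lemma sbr_commutator (K : fieldType) (n : nat) (A B : 'M[K]_n) :
  sbr n A B = A *m B - B *m A.
Proof.
have even (C : 'M[K]_n) : homog n false C.
  by move=> i j; rewrite /ipar [(n <= i)%N]leqNgt [(n <= j)%N]leqNgt !ltn_ord.
by rewrite (sbr_homog (even A) (even B)) scale1r.
Qed.

Lemma is_D4hatP (K : fieldType) (m : nat) (f : 'M[K]_4 -> K) : (0 < m)%N ->
  is_D4hat m f <-> f =1 @str K 4 m.
Proof.
move=> m_gt0.
have str_lin : scalar (@str K 4 m).
  move=> a A B; rewrite /str mulr_sumr -big_split; apply: eq_bigr => i _.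
  by rewrite !mxE /= mulrDr mulrCA.
have str1 : str m (D4 K) = 1.
  rewrite /str (bigD1 (inord 0)) //= big1 => [|i i0].
    by rewrite /ipar mxE !eqxx inordK // leqNgt m_gt0 expr0 mulr1 addr0.
  by rewrite mxE (negbTE i0) mulr0.
split=> [[f_lin f0 f1] A | fE]; last first.
  split=> [a A B | A A0 |]; rewrite !fE //; exact: str_lin.
have := f0 (- str m A *: D4 K + A).
by rewrite str_lin f_lin str1 f1 !mulr1 addNr => /(_ erefl) /eqP;
  rewrite addrC subr_eq0 => /eqP.
Qed.

(* Main.v *)
Require Import Defs.
From HB Require Import structures.
From mathcomp Require Import all_boot all_order all_algebra ring.
Set Implicit Arguments.
Unset Strict Implicit.
Unset Printing Implicit Defensive.
Import GRing.Theory.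
Local Open Scope ring_scope.

(** After subtraction of an inner derivation, respectively a coboundary, a
    derivation or a 2-cocycle of gl(m|n-m) is invariant under the diagonal
    torus. The roots e_i - e_j remain pairwise distinct modulo p, except that
    each equals its opposite if p = 2, so an invariant derivation acts on each
    E_ij by a scalar and an invariant cocycle pairs E_ij only with E_ji. What
    is left are additive functions on the roots, which are removed by a
    diagonal matrix, respectively by a functional on the diagonal, and the
    outer derivation str(.) 1. In all three cases of the theorem
    [h_1, h_2, h_3] and [D_4] combine to the identity matrix or its opposite. *)

Section GL.
Variables (K : fieldType) (n m : nat).
Implicit Types (i j k l r s : 'I_n) (A B C u x y : 'M[K]_n).

Let par i j := ipar m i (+) ipar m j.
Let e i j : 'M[K]_n := delta_mx i j.
Notation "[ x , y ]" := (sbr m x y).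

(** * Linear extension and the bracket on elementary matrices *)

Lemma linear_ext_delta (V : lmodType K) (f g : 'M[K]_n -> V) :
  linear f -> linear g -> (forall i j, f (e i j) = g (e i j)) -> f =1 g.
Proof.
move=> f_lin g_lin fg A.
(* The bare linearity hypotheses are packed into bundled linear maps, so that [linear_sum] and
   [linearZ] apply. *)
pose F : {linear 'M[K]_n -> V} :=
  HB.pack f (GRing.isLinear.Build _ _ _ _ f f_lin).
pose G : {linear 'M[K]_n -> V} :=
  HB.pack g (GRing.isLinear.Build _ _ _ _ g g_lin).
rewrite (matrix_sum_delta A) -[f]/(F : _ -> _) -[g]/(G : _ -> _) !linear_sum.
apply: eq_bigr => i _; rewrite !linear_sum; apply: eq_bigr => j _.
by rewrite !linearZ /=; congr (_ *: _); apply: fg.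
Qed.

Section LinearFun.
Variables (V : lmodType K) (f : 'M[K]_n -> V).
Hypothesis f_lin : linear f.

Lemma linear_fun0 : f 0 = 0.
Proof. by have := f_lin (-1) 0 0; rewrite scaler0 addr0 scaleN1r addNr. Qed.

Lemma linear_funZ a A : f (a *: A) = a *: f A.
Proof. by rewrite -[a *: A]addr0 f_lin linear_fun0 addr0. Qed.

Lemma linear_funD A B : f (A + B) = f A + f B.
Proof. by rewrite -[A]scale1r f_lin !scale1r. Qed.

Lemma linear_funB A B : f (A - B) = f A - f B.
Proof. by rewrite -[- B]scaleN1r linear_funD linear_funZ scaleN1r. Qed.

End LinearFun.

Lemma hpart_is_linear d : linear (@hpart K n m d).
Proof.
move=> a A B; apply/matrixP=> i j; rewrite !mxE.
by case: eqP => // _; rewrite mulr0 addr0.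
Qed.

Lemma sbr_linear_r A : linear (sbr m A).
Proof.
move=> a B C; rewrite /sbr scaler_sumr -big_split; apply: eq_bigr => b _ /=.
rewrite scaler_sumr -big_split; apply: eq_bigr => c _ /=.
rewrite hpart_is_linear mulmxDr mulmxDl -scalemxAr -scalemxAl.
move: (_ *m hpart m c B) (_ *m hpart m c C)
  (_ *m hpart m b A) (_ *m hpart m b A).
by move=> P Q R S; apply/matrixP=> i j; rewrite !mxE; ring.
Qed.

Lemma sbr_linear_l B : linear (@sbr K n m ^~ B).
Proof.
move=> a A C; rewrite /sbr scaler_sumr -big_split; apply: eq_bigr => b _ /=.
rewrite scaler_sumr -big_split; apply: eq_bigr => c _ /=.
rewrite hpart_is_linear mulmxDr mulmxDl -scalemxAr -scalemxAl.
move: (_ *m hpart m c B) (_ *m hpart m c B)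
  (_ *m hpart m b A) (_ *m hpart m b C).
by move=> P Q R S; apply/matrixP=> i j; rewrite !mxE; ring.
Qed.

Lemma str_scalar : scalar (@str K n m).
Proof.
move=> a A B; rewrite /str mulr_sumr -big_split; apply: eq_bigr => i _.
by rewrite !mxE /= mulrDr mulrCA.
Qed.

Lemma delta_homog i j : homog m (par i j) (e i j).
Proof.
move=> k l /eqP kl; rewrite mxE; case: eqP => [ki|//]; case: eqP => [lj|//].
by case: kl; rewrite ki lj.
Qed.

Lemma hpart_homog d A : homog m d (hpart m d A).
Proof. by move=> i j /negbTE ij; rewrite mxE ij. Qed.

Lemma hpartD A : A = hpart m false A + hpart m true A.
Proof.
by apply/matrixP=> i j; rewrite !mxE; case: (_ (+) _); rewrite ?addr0 ?add0r.
Qed.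

(** An even factor makes every sign trivial, so the bracket is a plain commutator even when [B]
    mixes parities. This is what allows entrywise computation with diagonal matrices. *)
Lemma sbr_even_l A B : homog m false A -> [A, B] = A *m B - B *m A.
Proof.
move=> hA; rewrite [in LHS](hpartD B) -[hpart m false B]scale1r sbr_linear_r.
rewrite !(sbr_homog hA (@hpart_homog _ _)) /= !expr0 !scale1r.
by rewrite [in RHS](hpartD B) mulmxDr mulmxDl addrACA opprD.
Qed.

Lemma sbr_even_r A B : homog m false B -> [A, B] = A *m B - B *m A.
Proof.
move=> hB; rewrite [in LHS](hpartD A) -[hpart m false A]scale1r sbr_linear_l.
rewrite !(sbr_homog (@hpart_homog _ _) hB) /= !expr0 !scale1r.
by rewrite [in RHS](hpartD A) mulmxDr mulmxDl addrACA opprD.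
Qed.

Lemma sbr_delta i j k l : [e i j, e k l] =
  (j == k)%:R *: e i l - ((-1) ^+ (par i j && par k l) * (l == i)%:R) *: e k j.
Proof.
rewrite (sbr_homog (@delta_homog _ _) (@delta_homog _ _)) !mul_delta_mx_cond.
by rewrite -scalerA !scaler_nat.
Qed.

(** * The action of the diagonal torus and its weights *)

Lemma diag_homog A : (forall i j, i != j -> A i j = 0) -> homog m false A.
Proof.
move=> dA i j; have [->|/dA //] := eqVneq i j; by rewrite addbb.
Qed.

Lemma delta_diag_homog k : homog m false (e k k).
Proof. by have := @delta_homog k k; rewrite /par addbb. Qed.

(** The value of the root e_i - e_j on E_kk, taken in [K] and hence modulo p. *)
Definition wt k i j : K := (i == k)%:R - (j == k)%:R.

Lemma delta_mulmxE k l A i j : (e k l *m A) i j = (i == k)%:R * A l j.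
Proof.
rewrite mxE (bigD1 l) //= big1 ?addr0 => [|r /negbTE rl].
  by rewrite mxE eqxx andbT.
by rewrite mxE rl andbF mul0r.
Qed.

Lemma mulmx_deltaE k l A i j : (A *m e k l) i j = A i k * (j == l)%:R.
Proof.
rewrite mxE (bigD1 k) //= big1 ?addr0 => [|r /negbTE rk].
  by rewrite mxE eqxx.
by rewrite mxE rk mulr0.
Qed.

Lemma sbr_delta_diag_mxE k A i j : [e k k, A] i j = wt k i j * A i j.
Proof.
rewrite (sbr_even_l _ (delta_diag_homog k)).
rewrite mxE [X in _ + X]mxE delta_mulmxE mulmx_deltaE /wt.
by have [->|_] := eqVneq i k; have [->|_] := eqVneq j k; rewrite /=; ring.
Qed.

Lemma sbrN_delta_diag_mxE k A i j : [A, e k k] i j = - (wt k i j * A i j).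
Proof.
rewrite -sbr_delta_diag_mxE (sbr_even_l _ (delta_diag_homog k)).
by rewrite (sbr_even_r _ (delta_diag_homog k)) -opprB mxE.
Qed.

Lemma sbr_delta_diag k i j : [e k k, e i j] = wt k i j *: e i j.
Proof.
apply/matrixP=> r s; rewrite sbr_delta_diag_mxE !mxE.
by case: eqP => [->|]; case: eqP => [->|]; rewrite ?mulr0.
Qed.

Lemma wt_head i j : i != j -> wt i i j = 1.
Proof. by rewrite /wt eqxx eq_sym => /negbTE->; rewrite subr0. Qed.

Lemma wt_tail i j : i != j -> wt j i j = -1.
Proof. by rewrite /wt eqxx => /negbTE->; rewrite sub0r. Qed.

Lemma wt_diag k i : wt k i i = 0.
Proof. by rewrite /wt subrr. Qed.

Lemma wtN k i j : wt k j i = - wt k i j.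
Proof. by rewrite /wt opprB. Qed.

(** Evaluation at k = i and k = j suffices: e_r - e_s must take the values 1 and -1 there. If r = j,
    then 1 = -1, which leaves only the swapped root in characteristic 2. *)
Lemma wt_inj i j r s : i != j -> (forall k, wt k i j = wt k r s) ->
  (r = i /\ s = j) \/ (2 = 0 :> K /\ r = j /\ s = i).
Proof.
move=> ij eq_wt; have ji : (j == i) = false by rewrite eq_sym (negbTE ij).
have /eqP := eq_wt i; have /eqP := eq_wt j.
rewrite wt_head // wt_tail // /wt.
have [->|rj] := eqVneq r j; have [->|sj] := eqVneq s j;
  rewrite ?ji ?eqxx /= ?(negbTE ij) ?subrr ?sub0r ?subr0 ?oppr_eq0 ?oner_eq0 //.
- rewrite eq_sym -addr_eq0 => /eqP two0.
  by have [->|_] := eqVneq s i; [right | rewrite oppr0 oner_eq0].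
- have [->|_] := eqVneq r i; first by left.
  by rewrite ?subr0 oner_eq0.
Qed.

(** * The second cohomology *)

Lemma H2_eq0_gl (o : 'I_n) : 2 != 0 :> K \/ (n <= m)%N ->
  H2_eq0 (@homog K n m) (@sbr K n m).
Proof.
move=> good w [[[w_linr w_linl] w_anti w_alt] w_coc _].
(* Off the diagonal the primitive is forced by [E_ii, E_ij] = E_ij. On the diagonal it is normalised
   by f(E_oo) = 0, and then [E_io, E_oi], which is E_ii plus or minus E_oo, forces f(E_ii). *)
pose f0 i j := if i == j then w (e i o) (e o i) else w (e i i) (e i j).
pose f A : K := \sum_i \sum_j A i j * f0 i j.
have f_lin : scalar f.
  move=> a A B; rewrite /f mulr_sumr -big_split; apply: eq_bigr => i _.
  rewrite mulr_sumr -big_split; apply: eq_bigr => j _ /=.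
  by rewrite !mxE; ring.
have fE i j : f (e i j) = f0 i j.
  rewrite /f (bigD1 i) //= [X in _ + X]big1 ?addr0 => [|k];
    last by move=> /negbTE ki; apply: big1 => l _; rewrite mxE ki mul0r.
  rewrite (bigD1 j) //= big1 ?addr0 => [|l /negbTE lj]; last first.
    by rewrite mxE lj andbF mul0r.
  by rewrite mxE !eqxx mul1r.
have fZ a A : f (a *: A) = a * f A by apply: (@linear_funZ K^o f f_lin).
have fZZ a b A B : f (a *: A - b *: B) = a * f A - b * f B.
  by rewrite f_lin -scaleNr fZ mulNr.
have wrZ x a y : w x (a *: y) = a * w x y.
  exact: (@linear_funZ K^o _ (w_linr x)).
have wrZZ x a b y z : w x (a *: y - b *: z) = a * w x y - b * w x z.
  by rewrite w_linr -scaleNr wrZ mulNr.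
have wlZ y a x : w (a *: x) y = a * w x y.
  exact: (@linear_funZ K^o _ (w_linl y)).
have wlZZ y a b x z : w (a *: x - b *: z) y = a * w x y - b * w z y.
  by rewrite w_linl -scaleNr wlZ mulNr.
have cocE i j k l r s : w [e i j, e k l] (e r s) =
    w (e i j) [e k l, e r s]
    - (-1) ^+ (par i j && par k l) * w (e k l) [e i j, e r s].
  by apply: w_coc; apply: delta_homog.
have antiE i j k l :
    w (e i j) (e k l) = - ((-1) ^+ (par i j && par k l) * w (e k l) (e i j)).
  by apply: w_anti; apply: delta_homog.
have par_diag i : par i i = false by rewrite /par addbb.
(* The cocycle identity with first argument E_kk: the torus acts on the pair by the sum of the two
   weights. *)
have coc_diag k i j l r :
    (wt k i j + wt k l r) * w (e i j) (e l r) = w (e k k) [e i j, e l r].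
  have := cocE k k i j l r.
  rewrite !sbr_delta_diag wlZ wrZ par_diag /= expr0 mul1r => /eqP.
  by rewrite eq_sym subr_eq => /eqP->; rewrite mulrDl.
have w_diag k i : w (e k k) (e i i) = 0.
  have [<-|ik] := eqVneq k i; first by apply: w_alt; apply: delta_diag_homog.
  (* E_ik and E_ki have total weight 0 and bracket to E_ii plus or minus E_kk; the E_kk term drops
     out by alternation. *)
  have := coc_diag k i k k i.
  rewrite wtN addNr mul0r sbr_delta !eqxx wrZZ mul1r.
  by rewrite (w_alt _ (delta_diag_homog k)) mulr0 subr0 => <-.
have w_cartan k i j : w (e k k) (e i j) = f [e k k, e i j].
  rewrite sbr_delta_diag fZ fE /f0; have [<-|ij] := eqVneq i j.
    by rewrite w_diag wt_diag mul0r.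
  have := coc_diag i k k i j; rewrite wt_diag add0r wt_head // mul1r => ->.
  by rewrite sbr_delta_diag wrZ.
have w_cartan_br k i j l r : w (e k k) [e i j, e l r]
    = (wt k i j + wt k l r) * f [e i j, e l r].
  rewrite sbr_delta wrZZ !w_cartan !sbr_delta_diag !fZ fZZ /wt.
  by have [->|_] := eqVneq j l; have [->|_] := eqVneq r i; rewrite /=; ring.
have w_opp i j : i != j -> w (e i j) (e j i) = f [e i j, e j i].
  move=> ij; have sgn2 (b : bool) : (-1) ^+ b * (-1) ^+ b = 1 :> K.
    by rewrite -expr2 sqrr_sign.
  rewrite sbr_delta !eqxx mulr1 fZZ !fE /f0 !eqxx.
  have [io|io] := eqVneq i o.
    rewrite io w_diag antiE /par.
    by case: (ipar m j); case: (ipar m o); rewrite /=; ring.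
  have [jo|jo] := eqVneq j o.
    by rewrite jo w_diag /=; ring.
  (* The root e_i - e_j is split through the base index: the identity on E_io, E_oj, E_ji expresses
     w(E_ij, E_ji) by the values that define [f] on the diagonal. *)
  have := cocE i o o j j i.
  have neqs := (negbTE io, negbTE jo, negbTE ij).
  rewrite !sbr_delta !eqxx ![o == _]eq_sym [j == i]eq_sym !neqs /=.
  rewrite wlZZ !wrZZ !mulr0 !mul0r !subr0.
  rewrite [w (e o j) _]antiE /par !mul1r => ->.
  by case: (ipar m i); case: (ipar m j); case: (ipar m o); rewrite /=; ring.
have wE i j l r : w (e i j) (e l r) = f [e i j, e l r].
  (* A nonzero total weight can be cancelled. Otherwise the two roots are opposite modulo p, and
     [wt_inj] leaves the pair E_ij, E_ji or, if p = 2, E_ij with itself. *)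
  have [/existsP[k nz]|] := boolP [exists k, wt k i j + wt k l r != 0].
    by apply: (mulfI nz); rewrite coc_diag w_cartan_br.
  rewrite negb_exists => /forallP/(_ _)/negPn/eqP wt0.
  have [<-|ij] := eqVneq i j; first by apply: w_cartan.
  have eq_wt k : wt k i j = wt k r l.
    by apply/eqP; rewrite [wt k r l]wtN -subr_eq0 opprK wt0.
  have [[-> ->]|[two0 [-> ->]]] := wt_inj ij eq_wt; first by apply: w_opp.
  (* Here 2 = 0, so [good] leaves only the purely even algebra, where alternation gives w(E_ij,
     E_ij) = 0. *)
  have ev : homog m false (e i j).
    case: good => [/eqP//|nm] k k'.
    by rewrite /ipar !(leqNgt m) !(leq_trans (ltn_ord _) nm).
  rewrite w_alt // sbr_delta [j == i]eq_sym (negbTE ij).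
  by rewrite mulr0 fZZ !mul0r subrr.
exists f => // x y.
apply: (@linear_ext_delta K^o (w^~ y) (fun x => f [x, y])) => [|a A B|i j].
- by move=> a A B; apply: w_linl.
- by rewrite sbr_linear_l f_lin.
apply: (@linear_ext_delta K^o (w (e i j)) (fun y => f [e i j, y])).
- by move=> a A B; apply: w_linr.
- by move=> a A B; rewrite sbr_linear_r f_lin.
- by move=> l r; apply: wE.
Qed.

(** * Derivations *)

Lemma homog_mul d d' A B :
  homog m d A -> homog m d' B -> homog m (d (+) d') (A *m B).
Proof.
move=> hA hB i j ij; rewrite mxE big1 // => k _.
have [ik|/hA->] := eqVneq (par i k) d; last by rewrite mul0r.
have [kj|/hB->] := eqVneq (par k j) d'; last by rewrite mulr0.
by case/eqP: ij; rewrite -ik -kj /par addbA addbK.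
Qed.

Lemma homogZD d a A B : homog m d A -> homog m d B -> homog m d (a *: A + B).
Proof. by move=> hA hB i j ij; rewrite !mxE hA // hB // mulr0 addr0. Qed.

Lemma sbr_homog_closed d d' A B :
  homog m d A -> homog m d' B -> homog m (d (+) d') [A, B].
Proof.
move=> hA hB; rewrite (sbr_homog hA hB) addrC -scaleNr.
by apply: homogZD; [rewrite addbC|]; apply: homog_mul.
Qed.

(** Both sides expand into the same signed associative monomials; the signs are checked for each
    choice of parities. *)
Lemma sbr_jacobi (d i l : bool) u x y :
  homog m d u -> homog m i x -> homog m l y ->
  [u, [x, y]] = [[u, x], y] + (-1) ^+ (d && i) *: [x, [u, y]].
Proof.
move=> hu hx hy.
rewrite (sbr_homog hu (sbr_homog_closed hx hy)) (sbr_homog hx hy).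
rewrite (sbr_homog (sbr_homog_closed hu hx) hy) (sbr_homog hu hx).
rewrite (sbr_homog hx (sbr_homog_closed hu hy)) (sbr_homog hu hy).
rewrite !mulmxBl !mulmxBr -!scalemxAl -!scalemxAr !mulmxA.
move: (u *m x *m y) (u *m y *m x) (x *m u *m y) => P1 P2 P3.
move: (x *m y *m u) (y *m u *m x) (y *m x *m u) => P4 P5 P6.
apply/matrixP=> r s; rewrite !mxE.
by case: d {hu}; case: i {hx}; case: l {hy}; rewrite /=; ring.
Qed.

Lemma inner_derivation d u :
  homog m d u -> derivation (@homog K n m) (@sbr K n m) d (sbr m u).
Proof.
move=> hu; split=> [||i x y hx]; first exact: sbr_linear_r.
  by move=> i x hx; rewrite addbC; apply: sbr_homog_closed.
rewrite [y]hpartD !(linear_funD (@sbr_linear_r _)) scalerDr.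
rewrite !(@sbr_jacobi d i _ u x _ hu hx (@hpart_homog _ _)).
by rewrite addrACA.
Qed.

Lemma derivationB d (D E : 'M[K]_n -> 'M[K]_n) :
    derivation (@homog K n m) (@sbr K n m) d D ->
    derivation (@homog K n m) (@sbr K n m) d E ->
  derivation (@homog K n m) (@sbr K n m) d (fun x => D x - E x).
Proof.
case=> D_lin D_hom D_der [E_lin E_hom E_der]; split.
- by move=> a A B; rewrite D_lin E_lin scalerBr opprD addrACA.
- move=> i x hx; rewrite addrC -scaleN1r.
  by apply: homogZD; [apply: E_hom | apply: D_hom].
move=> i x y hx; rewrite (D_der i) // (E_der i) //.
rewrite (linear_funB (@sbr_linear_l y)) (linear_funB (@sbr_linear_r x)).
move: [D x, y] [E x, y] [x, D y] [x, E y] => P1 P2 P3 P4.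
by apply/matrixP=> r s; rewrite !mxE; ring.
Qed.

(** Supplies an intermediate index for splitting a root, or a diagonal entry away from both i and
    j. *)
Lemma third_index i j : (2 < n)%N -> exists k, (k != i) && (k != j).
Proof.
move=> n3; apply/existsP; apply: contraLR n3; rewrite negb_exists -leqNgt.
move/forallP=> ijP; rewrite -[n in (n <= _)%N]card_ord.
apply: (@leq_trans #|[set i; j]|); last by rewrite cards2; case: (i != j).
apply/subset_leq_card/subsetP=> k _; rewrite !inE.
by have := ijP k; rewrite negb_and !negbK.
Qed.

Lemma str_delta i j : str m (e i j) = (i == j)%:R * (-1) ^+ ipar m i :> K.
Proof.
rewrite /str (bigD1 i) //= big1 ?addr0 => [|k /negbTE ki].
  by rewrite mxE eqxx mulrC eq_sym.
by rewrite mxE ki mulr0.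
Qed.

Section Derivations.
Variables (d : bool) (D : 'M[K]_n -> 'M[K]_n).
Hypothesis n_gt2 : (2 < n)%N.
Hypothesis char2 : 2 != 0 :> K \/ (n <= m)%N.
Hypothesis D_der : derivation (@homog K n m) (@sbr K n m) d D.

Let D_lin : linear D. Proof. by case: D_der. Qed.

Let D_delta i j k l : D [e i j, e k l] =
  [D (e i j), e k l] + (-1) ^+ (d && par i j) *: [e i j, D (e k l)].
Proof. by case: D_der => _ _; apply; apply: delta_homog. Qed.

Let D_hom i j : homog m (par i j (+) d) (D (e i j)).
Proof. by case: D_der => _ + _; apply; apply: delta_homog. Qed.

(** Applying [D] to [E_kk, E_ii] = 0 gives this at entry (i, j). It shows that, off the diagonal,
    [D] agrees on the torus with an inner derivation. *)
Lemma derivation_diag k i j : i != j ->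
  D (e k k) i j = wt k i j * D (e i i) i j.
Proof.
move=> ij; have := D_delta k k i i.
rewrite sbr_delta_diag wt_diag scale0r (linear_fun0 D_lin) => /matrixP/(_ i j).
rewrite mxE [RHS]mxE sbrN_delta_diag_mxE wt_head // mul1r.
rewrite [X in _ + X]mxE sbr_delta_diag_mxE /par addbb andbF mul1r.
by rewrite addrC => /esym/eqP; rewrite subr_eq0 => /eqP.
Qed.

Section WeightZero.
Hypothesis D_diag : forall k i j, i != j -> D (e k k) i j = 0.

(** Entry (r, s) of [D] applied to [E_kk, E_ij]: the diagonal matrix [D (e k k)] acts on E_ij by the
    difference of two of its entries. *)
Let D_diag_delta k i j r s :
  (wt k i j - wt k r s) * D (e i j) r s
    = (D (e k k) i i - D (e k k) j j) * e i j r s.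
Proof.
have := D_delta k k i j; rewrite sbr_delta_diag (linear_funZ D_lin).
rewrite (sbr_even_l _ (diag_homog (@D_diag k))) /par addbb andbF scale1r.
move/matrixP/(_ r s).
rewrite mxE [RHS]mxE [X in X + _]mxE [X in _ + X + _]mxE sbr_delta_diag_mxE.
rewrite mulmx_deltaE delta_mulmxE => eqD.
rewrite (mulrBl (D (e i j) r s)) eqD addrK mxE.
have [->|ri] := eqVneq r i; have [->|sj] := eqVneq s j;
  rewrite /= ?mulr0 ?mulr1 ?mul1r ?mul0r ?subrr //.
- by rewrite (D_diag _ (_ : j != s)) ?subrr // eq_sym.
- by rewrite D_diag ?subrr.
Qed.

Lemma weight0_derivation_scalar k i j : D (e k k) i i = D (e k k) j j.
Proof.
have [->//|ij] := eqVneq i j; apply/eqP; rewrite -subr_eq0; apply/eqP.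
by have := D_diag_delta k i j i j; rewrite subrr mul0r mxE !eqxx mulr1.
Qed.

(* A component of weight -(e_i - e_j), possible only if p = 2, is excluded by
   writing the root as (e_i - e_k) + (e_k - e_j). *)
Lemma weight0_derivation_delta i j :
  i != j -> D (e i j) = D (e i j) i j *: e i j.
Proof.
move=> ij; apply/matrixP=> r s; rewrite !mxE.
have [/andP[/eqP-> /eqP->]|rs] := boolP ((r == i) && (s == j)).
  by rewrite mulr1.
rewrite mulr0; apply/eqP/negP=> /negP nz.
have eq_wt k : wt k i j = wt k r s.
  apply/eqP; rewrite -subr_eq0; apply/eqP/(mulIf nz).
  by rewrite mul0r D_diag_delta mxE (negbTE rs) mulr0.
have [[ri sj]|[two0 [rj si]]] := wt_inj ij eq_wt.
  by rewrite ri sj !eqxx in rs.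
have even A : homog m false A.
  case: char2 => [/eqP//|nm] k k'.
  by rewrite /ipar !(leqNgt m) !(leq_trans (ltn_ord _) nm).
have [k /andP[ki kj]] := third_index i j n_gt2.
case/eqP: nz; have := D_delta i k k j.
rewrite sbr_delta eqxx scale1r [j == i]eq_sym (negbTE ij).
rewrite mulr0 scale0r subr0 => ->.
have subE (P Q : 'M[K]_n) k' l : (P - Q) k' l = P k' l - Q k' l by rewrite !mxE.
(* Each of the four products has zero entry at (j, i), because i, j, k are distinct. *)
rewrite !(sbr_even_l _ (even _)) rj si mxE [X in _ + X]mxE !subE.
rewrite !mulmx_deltaE !delta_mulmxE.
rewrite (negbTE ij) ![j == _]eq_sym (negbTE ij) [i == k]eq_sym (negbTE ki).
by rewrite (negbTE kj) /=; ring.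
Qed.

(** [D] sends each E_ij to a multiple of itself, or of the identity if i = j. Both have the parity
    of E_ij, whereas an odd map reverses it. *)
Lemma weight0_derivation_odd : d = true -> D =1 fun=> 0.
Proof.
move=> d1; apply: linear_ext_delta => // [a A B|i j].
  by rewrite scaler0 addr0.
have entry0 : D (e i j) i j = 0.
  by apply: D_hom; rewrite d1 /par; case: (ipar m i); case: (ipar m j).
have [ij|ij] := eqVneq i j; last first.
  by rewrite weight0_derivation_delta // entry0 ?scale0r.
apply/matrixP=> k l; rewrite mxE -ij in entry0 *.
have [<-|kl] := eqVneq k l; last exact: D_diag.
by rewrite (weight0_derivation_scalar i k i) entry0.
Qed.

Lemma weight0_derivation : exists u c,
  forall x, D x = [u, x] + (c * str m x) *: 1%:M.
Proof.
have [d1|d0] := boolP d.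
  exists 0, 0 => x; rewrite weight0_derivation_odd // mul0r scale0r addr0.
  by have := linear_fun0 (@sbr_linear_l x).
pose dd i j := D (e i j) i j.
have [o _] : exists o : 'I_n, true by exists (Ordinal (ltnW (ltnW n_gt2))).
pose lam k := D (e k k) o o.
have D_off i j : i != j -> D (e i j) = dd i j *: e i j.
  exact: weight0_derivation_delta.
have D_cartan k : D (e k k) = lam k *: 1%:M.
  apply/matrixP=> i j; rewrite !mxE /lam.
  have [<-|ij] := eqVneq i j; last by rewrite D_diag // mulr0.
  by rewrite mulr1; apply: weight0_derivation_scalar.
have dd_add i j k : i != j -> j != k -> i != k -> dd i k = dd i j + dd j k.
  move=> ij jk ik; have := D_delta i j j k.
  rewrite sbr_delta eqxx scale1r [k == i]eq_sym (negbTE ik) mulr0 scale0r subr0.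
  rewrite (negbTE d0) scale1r !D_off // (linear_funZ (@sbr_linear_l _)).
  rewrite (linear_funZ (@sbr_linear_r _)) -scalerDl sbr_delta eqxx scale1r.
  rewrite [k == i]eq_sym (negbTE ik) mulr0 scale0r subr0 => /matrixP/(_ i k).
  by rewrite !mxE !eqxx !mulr1.
have opp i j : i != j ->
    dd i j + dd j i = 0 /\ lam i = (-1) ^+ par i j * lam j.
  move=> ij; have [k /andP[ki kj]] := third_index i j n_gt2.
  have ji : j != i by rewrite eq_sym.
  have := D_delta i j j i.
  rewrite (negbTE d0) scale1r !D_off // (linear_funZ (@sbr_linear_l _)).
  rewrite (linear_funZ (@sbr_linear_r _)) -scalerDl sbr_delta !eqxx.
  rewrite mulr1 -scaleNr D_lin (linear_funZ D_lin) !D_cartan => eqD.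
  (* The left side lives on the entries i and j, while the right side is a scalar matrix. Entry (k,
     k) makes that scalar vanish, and then entry (i, i) makes [dd] odd. *)
  have := congr1 (fun A => A k k) eqD; have := congr1 (fun A => A i i) eqD.
  rewrite !mxE !eqxx (negbTE ki) (negbTE kj) (negbTE ij) /=.
  have -> : par i j && par j i = par i j by rewrite /par addbC andbb.
  rewrite !mulr0 !mulr1 !mul1r !addr0 mulr0 mulr1 => eqi.
  move/eqP; rewrite mulNr subr_eq0 => /eqP eql.
  by split=> //; rewrite -eqi eql mulNr subrr.
(* A potential for the additive function [dd]: dd i j = t i - t j, so the diagonal matrix of [t]
   accounts for [D] off the diagonal. *)
pose t i := if i == o then 0 else dd i o.
pose u : 'M[K]_n := diag_mx (\row_i t i).
(* By [opp], (-1)^p(i) lam i does not depend on i; its value at the base index is the coefficient of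
   the supertrace. *)
exists u, ((-1) ^+ ipar m o * lam o).
apply: linear_ext_delta => // [a A B|i j].
  rewrite sbr_linear_r str_scalar.
  move: [u, A] [u, B] => P Q.
  by apply/matrixP=> r s; rewrite !mxE; ring.
have hu : homog m false u.
  by apply: diag_homog => r s /negbTE rs; rewrite !mxE rs.
have -> : [u, e i j] = (t i - t j) *: e i j.
  rewrite (sbr_even_l _ hu) mul_diag_mx mul_mx_diag.
  by apply/matrixP=> r s; rewrite !mxE;
    have [->|_] := eqVneq r i; have [->|_] := eqVneq s j; rewrite /=; ring.
rewrite str_delta; have [<-|ij] := eqVneq i j.
  rewrite subrr scale0r add0r mul1r D_cartan; congr (_ *: _).
  have [->|io] := eqVneq i o; first by case: (ipar m o); rewrite /=; ring.
  rewrite (opp _ _ io).2 /par.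
  by case: (ipar m o); case: (ipar m i); rewrite /=; ring.
rewrite mul0r mulr0 scale0r addr0 D_off //; congr (_ *: _); rewrite /t.
have [io|io] := eqVneq i o; have [jo|jo] := eqVneq j o.
- by rewrite io jo eqxx in ij.
- by rewrite sub0r io; apply/eqP; rewrite -addr_eq0 (opp _ _ _).1 // eq_sym.
- by rewrite jo subr0.
have oj : o != j by rewrite eq_sym.
rewrite (dd_add i o j) //; congr (_ + _).
by apply/eqP; rewrite -addr_eq0 (opp _ _ oj).1.
Qed.

End WeightZero.
End Derivations.

(** * General derivations and the first cohomology *)

Lemma derivation_gl d (D : 'M[K]_n -> 'M[K]_n) :
    (2 < n)%N -> 2 != 0 :> K \/ (n <= m)%N ->
    derivation (@homog K n m) (@sbr K n m) d D ->
  exists u c, forall x, D x = [u, x] + (c * str m x) *: 1%:M.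
Proof.
move=> n_gt2 char2 D_der.
(* By [derivation_diag], subtracting the inner derivation of [v] removes the off-diagonal part of
   every D(E_kk). The minus sign comes from [v, E_kk] having entries -[wt k i j] v_ij. *)
pose v : 'M[K]_n := \matrix_(i, j) if i == j then 0 else - D (e i i) i j.
have hv : homog m d v.
  move=> i j ij; rewrite mxE; case: eqP => // _; apply/eqP.
  rewrite oppr_eq0; apply/eqP; case: D_der => _ D_hom _.
  by apply: (D_hom _ _ (delta_diag_homog i)).
have := derivationB D_der (inner_derivation hv).
case/(weight0_derivation n_gt2 char2) => [k i j ij|u [c D1E]].
  rewrite !mxE sbrN_delta_diag_mxE mxE (negbTE ij) (derivation_diag D_der k ij).
  by ring.
exists (v + u), c => x; rewrite (linear_funD (@sbr_linear_l x)) -addrA -D1E.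
by rewrite addrC subrK.
Qed.

Lemma str_sbr x y : str m [x, y] = 0 :> K.
Proof.
apply: (@linear_ext_delta K^o (fun x => str m [x, y]) (fun=> 0)).
- by move=> a A B; rewrite sbr_linear_l str_scalar.
- by move=> a A B; rewrite scaler0 addr0.
move=> i j.
apply: (@linear_ext_delta K^o (fun y => str m [e i j, y]) (fun=> 0)).
- by move=> a A B; rewrite sbr_linear_r str_scalar.
- by move=> a A B; rewrite scaler0 addr0.
move=> k l; rewrite sbr_delta -scaleNr str_scalar.
rewrite (linear_funZ (V := K^o) str_scalar) !str_delta [l == i]eq_sym.
rewrite [k == j]eq_sym /par /GRing.scale /=.
have [->|_] := eqVneq j k; have [->|_] := eqVneq i l; rewrite /=; try ring.
by case: (ipar m k); case: (ipar m l); rewrite /=; ring.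
Qed.

Lemma str_odd x : homog m true x -> str m x = 0 :> K.
Proof. by move=> hx; rewrite /str big1 // => i _; rewrite hx ?addbb ?mulr0. Qed.

Lemma scalar_homog a : homog m false (a *: 1%:M : 'M[K]_n).
Proof. by apply: diag_homog => i j /negbTE ij; rewrite !mxE ij mulr0. Qed.

(** The Leibniz rule reduces to 0 = 0: the supertrace kills brackets and the identity matrix is
    central. *)
Lemma scalar_derivation a :
  derivation (@homog K n m) (@sbr K n m) false
    (fun x => (a * str m x) *: 1%:M).
Proof.
split=> [b A B|i x hx|i x y hx].
- by rewrite str_scalar; apply/matrixP=> r s; rewrite !mxE; ring.
- case: i hx => [/str_odd-> | _]; last exact: scalar_homog.
  by rewrite mulr0 scale0r => r s _; rewrite mxE.
rewrite str_sbr mulr0 scale0r (sbr_even_l _ (@scalar_homog _)).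
rewrite (sbr_even_r _ (@scalar_homog _)) -!scalemxAl -!scalemxAr.
by rewrite !mul1mx !mulmx1 !subrr scaler0 addr0.
Qed.

Lemma H1_basis_gl (a : K) (s : 'I_1 -> 'M[K]_n -> 'M[K]_n) :
    (0 < m)%N -> (2 < n)%N -> 2 != 0 :> K \/ (n <= m)%N -> a != 0 ->
    (forall (k : 'I_1) x, s k x = (a * str m x) *: 1%:M) ->
  H1_basis (@homog K n m) (@sbr K n m) s.
Proof.
move=> m_gt0 n_gt2 char2 a0 sE; split=> [k|D|b [u uE] k].
- exists false; have [lin hom der] := scalar_derivation a.
  by split=> [c A B|i x hx|i x y hx]; rewrite !sE;
    [apply: lin | apply: hom | apply: der].
- case=> D0 [D1 [/(derivation_gl n_gt2 char2)[u0 [c0 D0E]]]].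
  case/(derivation_gl n_gt2 char2)=> [u1 [c1 D1E]] DE.
  exists (fun=> (c0 + c1) / a), (u0 + u1) => x.
  rewrite big_ord1 sE DE D0E D1E (linear_funD (@sbr_linear_l x)).
  by rewrite scalerA mulrA divfK // addrACA -scalerDl -mulrDl addrK.
pose o := Ordinal (ltnW (ltnW n_gt2)); pose o1 := Ordinal (ltnW n_gt2).
(* An inner derivation sends E_oo to a matrix with zero diagonal, whereas str(E_oo) = 1 since
   [m_gt0] makes the first index even. *)
have := uE (e o o) => /matrixP/(_ o1 o1).
rewrite sbrN_delta_diag_mxE wt_diag mul0r oppr0 big_ord1 sE str_delta eqxx.
rewrite !mxE eqxx /ipar leqNgt m_gt0 expr0 !mulr1 => /eqP.
rewrite mulf_eq0 (negbTE a0) orbF => /eqP; by rewrite (ord1 k).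
Qed.

End GL.

(** * The three algebras of the theorem *)

Lemma hgE (K : fieldType) m i : hg K m i = Eij K i i
  - (-1) ^+ (ipar m (inord i.-1 : 'I_4) (+) ipar m (inord i : 'I_4))
    *: Eij K i.+1 i.+1.
Proof.
rewrite /hg /xg /yg /Eij sbr_delta !eqxx scale1r mulr1 /=.
by case: (ipar m _); case: (ipar m _).
Qed.

Lemma scalar_mx4E (K : fieldType) (a : K) :
  a *: 1%:M = a *: (Eij K 1 1 + Eij K 2 2 + Eij K 3 3 + Eij K 4 4).
Proof.
rewrite mx1_sum_delta !big_ord_recr big_ord0 /= add0r /Eij.
by congr (_ *: (_ + _ + _ + _));
  congr delta_mx; apply/val_inj; rewrite /= inordK.
Qed.

Theorem lemma2p17 (K : closedFieldType) (p : nat) (hp : p \in [pchar K]) :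
  [/\ (p = 2%N ->
        (forall D4hat : 'M[K]_4 -> K, is_D4hat 4 D4hat ->
          H1_basis (@homog K 4 4) (@sbr K 4 4)
            (fun _ : 'I_1 => (hg K 4 1 \ox D4hat) \+ (hg K 4 3 \ox D4hat)))
        /\ H2_eq0 (@homog K 4 4) (@sbr K 4 4)),
      ((2 < p)%N ->
        (forall D4hat : 'M[K]_4 -> K, is_D4hat 2 D4hat ->
          H1_basis (@homog K 4 2) (@sbr K 4 2)
            (fun _ : 'I_1 =>
               (((- hg K 2 1) \ox D4hat)
                \+ (((p - 2)%:R *: hg K 2 2) \ox D4hat))
               \+ (hg K 2 3 \ox D4hat)))
        /\ H2_eq0 (@homog K 4 2) (@sbr K 4 2))
    & ((2 < p)%N ->
        (forall D4hat : 'M[K]_4 -> K, is_D4hat 1 D4hat ->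
          H1_basis (@homog K 4 1) (@sbr K 4 1)
            (fun _ : 'I_1 =>
               (((((p - 3)%:R *: hg K 1 1) \ox D4hat)
                 \+ ((2%:R *: hg K 1 2) \ox D4hat))
                \+ (hg K 1 3 \ox D4hat))
               \+ ((2%:R *: D4 K) \ox D4hat)))
        /\ H2_eq0 (@homog K 4 1) (@sbr K 4 1))].
Proof.
have p0 : p%:R = 0 :> K := pcharf0 hp.
have natrBp k : (k <= p)%N -> (p - k)%:R = - k%:R :> K.
  by move=> kp; rewrite natrB // p0 sub0r.
have two_neq0 : (2 < p)%N -> 2 != 0 :> K.
  by move=> p2; rewrite -(dvdn_pcharf hp) gtnNdvd.
have mN1 : -1 != 0 :> K by rewrite oppr_eq0 oner_eq0.
split=> p2.
- split=> [D4hat /is_D4hatP hD|]; last exact: H2_eq0_gl ord0 (or_intror _).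
  have two0 : 2 = 0 :> K by rewrite -p2.
  apply: (@H1_basis_gl K 4 4 1) => // [||_ x].
  + by right.
  + exact: oner_neq0.
  (* Since -1 = 1, h_1 + h_3 = E_11 - E_22 + E_33 - E_44 is the identity. *)
  rewrite /= /tensor hD // scalar_mx4E !hgE /ipar !inordK //= -scalerDr mul1r.
  congr (_ *: _); move: (Eij K 1 1) (Eij K 2 2) (Eij K 3 3) (Eij K 4 4).
  have N1 : -1 = 1 :> K.
    by apply/eqP; rewrite -subr_eq0 -opprD oppr_eq0; apply/eqP.
  by move=> P Q R S; rewrite !scale1r -!scaleN1r N1 !scale1r addrA.
- split=> [D4hat /is_D4hatP hD|];
    last by apply: H2_eq0_gl ord0 (or_introl (two_neq0 p2)).
  apply: (@H1_basis_gl K 4 2 (-1)) => // [|_ x]; first by left; apply: two_neq0.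
  (* With p - 2 = -2 in [K], the combination -h_1 - 2 h_2 + h_3 is minus the identity. *)
  rewrite /= /tensor hD // scalar_mx4E !hgE /ipar !inordK //=.
  rewrite (natrBp _ (ltnW p2)).
  move: (Eij K 1 1) (Eij K 2 2) (Eij K 3 3) (Eij K 4 4) => P Q R S.
  by apply/matrixP=> i j; rewrite !mxE; ring.
- split=> [D4hat /is_D4hatP hD|];
    last by apply: H2_eq0_gl ord0 (or_introl (two_neq0 p2)).
  apply: (@H1_basis_gl K 4 1 (-1)) => // [|_ x]; first by left; apply: two_neq0.
  (* With p - 3 = -3 in [K], the combination -3 h_1 + 2 h_2 + h_3 + 2 D_4 is minus the identity. *)
  rewrite /= /tensor hD // scalar_mx4E !hgE /D4 /ipar !inordK //= natrBp //.
  move: (Eij K 1 1) (Eij K 2 2) (Eij K 3 3) (Eij K 4 4) => P Q R S.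
  by apply/matrixP=> i j; rewrite !mxE; ring.
Qed.
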